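(* Let $\lambda:\widehat{\mathrm{PL}}_{\mathbb{Q}(q)}\to\mathbb{Q}(q)[[x]]_+$ be the unique continuous morphism of pre-Lie algebras sending $\bullet$ to $x$, where $\mathbb{Q}(q)[[x]]_+$ is the algebra of formal power series in $x$ without constant term, regarded as a pre-Lie algebra with its associative product as pre-Lie product. Then the image of $\Omega_q$ by $\lambda$ is the $q$-logarithm $$\log_q(x)=\sum_{n\ge1}\frac{(-1)^{n-1}}{[n]_q}x^n,$$ where $[n]_q=1+q+\dots+q^{n-1}$.
   Context: For a field $K$ ($K=\mathbb{Q}$ or $\mathbb{Q}(q)$, $q$ an indeterminate), $\mathrm{PL}=\bigoplus_{n\ge1}\mathrm{PL}_n$ is the $K$-vector space with basis the isomorphism classes of (unlabeled, non-planar) rooted trees, graded by the number $\#T$ of vertices. The pre-Lie product is $T\curvearrowleft T'=\sum_{v}$ (tree obtained from $T\sqcup T'$ by adding an edge from the root of $T'$ to $v$), sum over vertices $v$ of $T$, the root being that of $T$. Denote by $\bullet$ the one-vertex tree; $\mathrm{PL}$ is the free (right) pre-Lie algebra on $\bullet$, and a Lie algebra for $[x,y]=x\curvearrowleft y-y\curvearrowleft x$. Let $\widehat{\mathrm{PL}}=\prod_{n\ge1}\mathrm{PL}_n$ and let $\widehat U(\mathrm{PL})$ be the (degree-)completed universal enveloping algebra, with associative product $\star$. The product $\curvearrowleft$ is a right action of the Lie algebra, so extends to a right action of $\widehat U(\mathrm{PL})$ on $\widehat{\mathrm{PL}}$: $x\curvearrowleft(u\star v)=(x\curvearrowleft u)\curvearrowleft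 v$. Exponentials are computed in $\widehat U(\mathrm{PL})$. $\Omega\in\widehat{\mathrm{PL}}_{\mathbb{Q}}$ is the unique solution of $\bullet\curvearrowleft\left(\frac{\Omega}{\exp(\Omega)-1}\right)=\Omega$, where $\frac{x}{e^x-1}$ is expanded as a power series. For $A=\sum_{n\ge 1}A_n$ (homogeneous components), $A[q]=\sum_n q^nA_n$. $\Omega_q\in\widehat{\mathrm{PL}}_{\mathbb{Q}(q)}$ is the unique solution of $$\Omega_q[q]\curvearrowleft(\exp(\Omega)-1)+\Omega_q[q]-\Omega_q=\bullet\curvearrowleft\Omega_q+(q-1)\bullet .$$ (The morphism $\lambda$ sends the linear tree with $n$ vertices to $x^n$ and all other rooted trees to $0$.) *)

(* Defs.v *)
From HB Require Import structures.
From mathcomp Require Import all_boot all_order all_algebra.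
From mathcomp Require Import boolp classical_sets functions fsbigop.

Set Implicit Arguments.
Unset Strict Implicit.
Unset Printing Implicit Defensive.

Import GRing.Theory.
Local Open Scope ring_scope.
Local Open Scope quotient_scope.

(** * Rooted trees *)

(* Planar rooted trees; they only serve as representatives. *)
Inductive ptree : Type := PNode of seq ptree.

HB.instance Definition _ := gen_eqMixin ptree.
HB.instance Definition _ := gen_choiceMixin ptree.

(* Isomorphism of the underlying non-planar rooted trees: the children of every
   vertex may be permuted. *)
Inductive ptree_iso : ptree -> ptree -> Prop :=
| ptree_iso_nil : ptree_iso (PNode [::]) (PNode [::])
| ptree_iso_cons t t' s s' :
    ptree_iso t t' -> ptree_iso (PNode s) (PNode s') ->
    ptree_iso (PNode (t :: s)) (PNode (t' :: s'))
| ptree_iso_swap t u s :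
    ptree_iso (PNode (t :: u :: s)) (PNode (u :: t :: s))
| ptree_iso_trans t u v :
    ptree_iso t u -> ptree_iso u v -> ptree_iso t v.

Fixpoint ptree_iso_refl (t : ptree) : ptree_iso t t :=
  let: PNode s := t in
  (fix children (s : seq ptree) : ptree_iso (PNode s) (PNode s) :=
     if s is t' :: s' then ptree_iso_cons (ptree_iso_refl t') (children s')
     else ptree_iso_nil) s.

Lemma ptree_iso_sym t u : ptree_iso t u -> ptree_iso u t.
Proof.
elim=> [|t1 t2 s1 s2 _ ht _ hs|t1 t2 s|t1 t2 t3 _ h12 _ h23].
- exact: ptree_iso_nil.
- exact: ptree_iso_cons.
- exact: ptree_iso_swap.
- exact: ptree_iso_trans h23 h12.
Qed.

Definition ptree_eqv (t u : ptree) : bool := `[< ptree_iso t u >].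

Lemma ptree_eqv_is_equiv : equiv_class_of ptree_eqv.
Proof.
split=> [t|t u|u t v].
- by apply/asboolP; exact: ptree_iso_refl.
- by apply/asboolP/asboolP; exact: ptree_iso_sym.
- by move=> /asboolP h1 /asboolP h2; apply/asboolP; exact: ptree_iso_trans h1 h2.
Qed.

Canonical ptree_eqv_equiv := EquivRelPack ptree_eqv_is_equiv.
Canonical ptree_eqv_encModRel := defaultEncModRel ptree_eqv.

Definition rtree := {eq_quot ptree_eqv}.

Fixpoint psize (t : ptree) : nat :=
  let: PNode s := t in (sumn (map psize s)).+1.

Definition tsize (T : rtree) : nat := psize (repr T).

Definition leaf : rtree := \pi_rtree (PNode [::]).

(* The trees obtained by adding an edge from the root of u to a vertex v of t,
   one entry for each v. *)
Fixpoint pgraft (u t : ptree) : seq ptree :=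
  let: PNode s := t in
  PNode (u :: s) ::
    map PNode
      ((fix below (s : seq ptree) : seq (seq ptree) :=
          if s is t' :: s' then
            [seq t'' :: s' | t'' <- pgraft u t'] ++
            [seq t' :: s'' | s'' <- below s']
          else [::]) s).

Definition tgraft (T U : rtree) : seq rtree :=
  [seq \pi_rtree t | t <- pgraft (repr U) (repr T)].

(** * The completed free pre-Lie algebra *)

(* There are finitely many trees with n vertices, so the product over n of the
   spaces PL_n is the space of all functions on trees; f T is the coefficient
   of T.  The values are in K^o so that the pointwise structure is a K-module. *)
Definition PLhat (K : fieldType) : Type := rtree -> K^o.
HB.instance Definition _ (K : fieldType) := GRing.Lmodule.on (PLhat K).

Section PreLie.
Variable K : fieldType.
Implicit Types f g x : PLhat K.

Definition tbasis (T : rtree) : PLhat K := fun U => (U == T)%:R.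

Definition bullet : PLhat K := tbasis leaf.

(* Only the finitely many pairs with tsize p.1 + tsize p.2 = tsize T give a
   nonzero term. *)
Definition prelie f g : PLhat K := fun T =>
  \sum_(p \in [set: rtree * rtree])
     f p.1 * g p.2 *+ count_mem T (tgraft p.1 p.2).

Definition lie f g : PLhat K := prelie f g - prelie g f.

(* A |-> A[q] *)
Definition qscale (q : K) f : PLhat K := fun T => q ^+ tsize T * f T.

End PreLie.

(** * The completed universal enveloping algebra *)

(* Completed tensor algebra on PL: the words in trees form a basis of the tensor
   algebra, and finitely many words have a given total number of vertices. *)
Definition That (K : fieldType) : Type := seq rtree -> K^o.
HB.instance Definition _ (K : fieldType) := GRing.Lmodule.on (That K).

(* Power series in one variable x; the coefficient of x^n is the value at n. *)
Definition pseries (K : fieldType) : Type := nat -> K^o.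
HB.instance Definition _ (K : fieldType) := GRing.Lmodule.on (pseries K).

Section Enveloping.
Variable K : fieldType.
Implicit Types (f g x : PLhat K) (u v : That K).

Definition wsize (w : seq rtree) : nat := sumn (map tsize w).

Definition tone : That K := fun w => (w == [::])%:R.

Definition tmul u v : That K := fun w =>
  \sum_(i < (size w).+1) u (take i w) * v (drop i w).

Definition tpow u (n : nat) : That K := iter n (tmul u) tone.

Definition tinj f : That K := fun w => if w is [:: T] then f T else 0.

(* The two-sided ideal generated by f g - g f - [f, g]. *)
Inductive lie_ideal : That K -> Prop :=
| lie_ideal_gen f g :
    lie_ideal (tmul (tinj f) (tinj g) - tmul (tinj g) (tinj f) - tinj (lie f g))
| lie_ideal_add u v : lie_ideal u -> lie_ideal v -> lie_ideal (u + v)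
| lie_ideal_mull u v : lie_ideal v -> lie_ideal (tmul u v)
| lie_ideal_mulr u v : lie_ideal u -> lie_ideal (tmul u v).

(* Its closure for the degree topology. *)
Definition lie_ideal_closure : That K -> bool := fun u =>
  `[< forall n : nat, exists2 v, lie_ideal v &
        forall w, (wsize w <= n)%N -> u w = v w >].

Lemma lie_ideal0 : lie_ideal 0.
Proof.
have := lie_ideal_mull 0 (lie_ideal_gen 0 0); congr lie_ideal.
by apply/funext => w; rewrite /tmul big1 // => i _; rewrite mul0r.
Qed.

Lemma lie_idealN u : lie_ideal u -> lie_ideal (- u).
Proof.
move=> /(lie_ideal_mull (- tone)); congr lie_ideal.
apply/funext => w; rewrite /tmul (bigD1 ord0) //= take0 drop0.
rewrite big1 ?addr0 => [|i i0].
  by rewrite /tone !fctE eqxx mulN1r.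
rewrite /tone !fctE; case: w i i0 => [|T w] [[|i] lti] //= _.
by rewrite oppr0 mul0r.
Qed.

Lemma lie_ideal_closure_zmod : zmod_closed lie_ideal_closure.
Proof.
split=> [|u v /asboolP hu /asboolP hv]; apply/asboolP => n.
  by exists 0 => //; exact: lie_ideal0.
have [u' Iu eu] := hu n; have [v' Iv ev] := hv n.
exists (u' - v') => [|w wn]; first exact: lie_ideal_add Iu (lie_idealN Iv).
by rewrite !fctE eu ?ev.
Qed.

HB.instance Definition _ :=
  GRing.isZmodClosed.Build (That K) lie_ideal_closure lie_ideal_closure_zmod.

Definition Uhat : Type :=
  @Quotient.quot (That K) (GRing.ZmodClosed.clone (That K) lie_ideal_closure _).
HB.instance Definition _ := GRing.Zmodule.on Uhat.
HB.instance Definition _ := Quotient.on Uhat.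

Definition Umul (a b : Uhat) : Uhat := \pi_Uhat (tmul (repr a) (repr b)).

Definition Uone : Uhat := \pi_Uhat tone.

(* The sum over n of c_n f^n in Uhat.  It is computed on words, where it
   converges because f has no component in degree 0; the projection onto Uhat
   is a continuous algebra morphism. *)
Definition Useries (c : pseries K) f : Uhat :=
  \pi_Uhat (fun w => \sum_(n < (size w).+1) c n * tpow (tinj f) n w).

(* A word T_1 ... T_k acts on x by (...(x <- T_1) <- ...) <- T_k. *)
Definition wact x (w : seq rtree) : PLhat K :=
  foldl (fun y T => prelie y (tbasis K T)) x w.

(* For a given T, only the finitely many words with wsize w < tsize T
   contribute. *)
Definition tact x u : PLhat K := fun T =>
  \sum_(w \in [set: seq rtree]) u w * wact x w T.

(* The right action of Uhat.  The closed ideal acts by zero, because of the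
   pre-Lie identity, so the choice of the representative is irrelevant. *)
Definition act x (a : Uhat) : PLhat K := tact x (repr a).

End Enveloping.

(** * Power series in one variable *)

Section PowerSeries.
Variable K : fieldType.
Implicit Types a b : pseries K.

Definition ps_mul a b : pseries K := fun n =>
  \sum_(i < n.+1) a i * b (n - i)%N.

Definition ps_X : pseries K := fun n => (n == 1%N)%:R.

Definition ps_one : pseries K := fun n => (n == 0%N)%:R.

Definition ps_exp : pseries K := fun n => (n`!%:R)^-1.

(* The first n coefficients of x / (e^x - 1), from the recursion given by
   ps_todd_mul below. *)
Fixpoint todd_prefix (n : nat) : seq K :=
  if n is m.+1 then
    let s := todd_prefix m in
    rcons s ((m == 0%N)%:R - \sum_(k < m) s`_k / ((m - k).+1)`!%:R)
  else [::].

Definition ps_todd : pseries K := fun n => (todd_prefix n.+1)`_n.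

Lemma size_todd_prefix n : size (todd_prefix n) = n.
Proof. by elim: n => //= n ihn; rewrite size_rcons ihn. Qed.

Lemma nth_todd_prefix n k : (k < n)%N -> (todd_prefix n)`_k = ps_todd k.
Proof.
elim: n => // n ihn; rewrite ltnS leq_eqVlt => /orP[/eqP -> //|kn].
by rewrite -ihn //= nth_rcons size_todd_prefix kn.
Qed.

Lemma ps_todd_mul : ps_mul ps_todd (ps_exp - ps_one) = ps_X.
Proof.
apply/funext => -[|n]; rewrite /ps_mul /ps_X /ps_one /ps_exp.
  by rewrite big_ord1 !fctE subnn fact0 invr1 subrr mulr0.
rewrite big_ord_recr /= subnn !fctE fact0 invr1 subrr mulr0 addr0.
rewrite big_ord_recr /= subSn // subnn factS fact0 muln1 invr1 subr0 mulr1.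
rewrite {2}/ps_todd /= nth_rcons size_todd_prefix ltnn eqxx.
rewrite addrC eqSS -[RHS]addr0 -[LHS]addrA; congr (_ + _).
apply/eqP; rewrite addrC subr_eq0; apply/eqP; apply: eq_bigr => i _.
by rewrite nth_todd_prefix // subSn ?subr0 // ltnW.
Qed.

(* Continuous morphisms of pre-Lie algebras from PLhat to K[[x]]_+, the power
   series without constant term, with the Cauchy product as pre-Lie product.
   Both sides carry the degree topology. *)
Record continuous_prelie_morphism (lam : PLhat K -> pseries K) : Prop :=
  ContinuousPrelieMorphism {
    cpm_plus : forall f, lam f 0%N = 0;
    cpm_linear : forall (c : K) (f g : PLhat K),
      lam (c *: f + g) = c *: lam f + lam g;
    cpm_prelie : forall f g, lam (prelie f g) = ps_mul (lam f) (lam g);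
    cpm_continuous : forall (f : PLhat K) (n : nat), exists m : nat,
      forall g : PLhat K,
      (forall T, (tsize T <= m)%N -> g T = f T) ->
      forall k, (k <= n)%N -> lam g k = lam f k
  }.

Definition qint (q : K) (n : nat) : K := \sum_(i < n) q ^+ i.

Definition qlog (q : K) : pseries K := fun n =>
  if n is m.+1 then (-1) ^+ m / qint q n else 0.

End PowerSeries.

(** * The series Omega and Omega_q *)

Definition Qq : fieldType := {fraction {poly rat}}.

Definition q : Qq := tofrac 'X.

(* Extension of scalars from Q to Q(q). *)
Definition PLhat_Qq (f : PLhat rat) : PLhat Qq := fun T => tofrac (f T)%:P.

Definition is_Omega (Omega : PLhat rat) : Prop :=
  act (bullet rat) (Useries (@ps_todd rat) Omega) = Omega.

Definition is_Omega_q (Omega : PLhat rat) (Omega_q : PLhat Qq) : Prop :=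
  let expOmega := Useries (@ps_exp Qq) (PLhat_Qq Omega) in
  act (qscale q Omega_q) (expOmega - Uone Qq) + qscale q Omega_q - Omega_q
  = prelie (bullet Qq) Omega_q + (q - 1) *: bullet Qq.

(* Main.v *)
Require Import Defs.
From mathcomp Require Import all_boot all_order all_algebra.
From mathcomp Require Import zify boolp classical_sets functions fsbigop.

Set Implicit Arguments.
Unset Strict Implicit.
Unset Printing Implicit Defensive.

Import Defs GRing.Theory.
Local Open Scope ring_scope.
Local Open Scope quotient_scope.

(* The coefficients on linear trees ("ladders") give a continuous pre-Lie
   morphism ell to power series, and any morphism lam as in the theorem equals
   ell because the one-vertex tree generates PL.  Summing the coefficients of
   the words of ladders of given weight gives an algebra morphism wsum on the
   tensor algebra which kills the closed Lie ideal, since power series commute,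
   and ell (act x a) = ell x * wsum a.  Write w for the image of Omega and L for
   that of Omega_q.  The first equation becomes x * (w / (e^w - 1)) = w, so that
   e^w - 1 = x, and then the second one becomes
   (1 + x) (L(qx) - L(x)) = (q - 1) x, which determines the coefficients of L. *)

(** * Linear trees and the graftings that produce them *)

Definition pladder (n : nat) : ptree := iter n (fun t => PNode [:: t]) (PNode [::]).

Definition ladder (n : nat) : rtree := \pi_rtree (pladder n).

Lemma pladder_inj : injective pladder.
Proof. by elim=> [|m IH] [|n] //= [/IH ->]. Qed.

(** An isomorphism only permutes children, and no vertex of a linear tree has two of them, so the
    swap case is void. *)
Lemma ptree_iso_pladder t u n : ptree_iso t u -> t = pladder n -> u = pladder n.
Proof.
move=> tu; elim: tu n => {t u} [|t t' s s' _ iht _ ihs|t u s|t u v _ ihu _ ihv] n.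
- by [].
- case: n => //= n [/iht -> s0]; congr PNode; congr cons.
  by have := ihs 0%N (congr1 PNode s0); case.
- by case: n.
- by move=> /ihu /ihv.
Qed.

Lemma rtree_eqP (t u : ptree) : reflect (ptree_iso t u) (\pi_rtree t == \pi_rtree u).
Proof. by apply: (iffP eqP) => [/eqquotP/asboolP|h]; last exact/eqquotP/asboolP. Qed.

Lemma iso_repr (t : ptree) : ptree_iso t (repr (\pi_rtree t)).
Proof. by apply/rtree_eqP; rewrite reprK. Qed.

Lemma pi_eq_ladder t n : (\pi_rtree t == ladder n) = (t == pladder n).
Proof.
apply/rtree_eqP/eqP => [|->]; last exact: ptree_iso_refl.
by move=> /ptree_iso_sym/ptree_iso_pladder; apply.
Qed.

Lemma repr_ladder n : repr (ladder n) = pladder n.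
Proof. by apply/eqP; rewrite -pi_eq_ladder reprK. Qed.

Lemma eq_ladder T n : (T == ladder n) = (repr T == pladder n).
Proof. by rewrite -pi_eq_ladder reprK. Qed.

Lemma ladder_inj : injective ladder.
Proof. by move=> m n /eqP; rewrite eq_ladder repr_ladder => /eqP/pladder_inj. Qed.

Lemma leaf_ladder : leaf = ladder 0.
Proof. by []. Qed.

Lemma psize_pladder n : psize (pladder n) = n.+1.
Proof. by elim: n => //= n ->; rewrite addn0. Qed.

Lemma tsize_ladder n : tsize (ladder n) = n.+1.
Proof. by rewrite /tsize repr_ladder psize_pladder. Qed.

(** Gives a name to the inner fixpoint of [pgraft], so that inductions can be run on it. *)
Definition pgraft_below (u : ptree) : seq ptree -> seq (seq ptree) :=
  fix below s :=
    if s is t' :: s' then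
      [seq t'' :: s' | t'' <- pgraft u t'] ++ [seq t' :: s'' | s'' <- below s']
    else [::].

Lemma pgraftE u s : pgraft u (PNode s) = PNode (u :: s) :: map PNode (pgraft_below u s).
Proof. by []. Qed.

(** Each such grafting modifies one child in place; this separates it from the grafting at the root,
    which adds a child. *)
Lemma size_pgraft_below u s s' : s' \in pgraft_below u s -> size s' = size s.
Proof.
elim: s s' => //= t s IH s'; rewrite mem_cat => /orP[] /mapP[r hr ->] //=.
by rewrite (IH _ hr).
Qed.

Lemma ptree_ind_nested (P : ptree -> Prop) :
  (forall s, (forall t, t \in s -> P t) -> P (PNode s)) -> forall t, P t.
Proof.
move=> h t; have [n] := ubnP (psize t).
elim: n t => // n IH [s] /= sn; apply: h => t ts; apply: IH.
by move: sn; rewrite (perm_sumn (perm_map _ (perm_to_rem ts))) /=; lia.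
Qed.

Lemma psize_pgraft u t t' : t' \in pgraft u t -> psize t' = (psize t + psize u)%N.
Proof.
elim/ptree_ind_nested: t t' => s IH t'; rewrite pgraftE inE => /predU1P[->|].
  by rewrite /= addnC addSn.
case/mapP => s' hs' ->; rewrite /= addSn; congr _.+1.
elim: s s' hs' IH => //= t s ihs s' hs' IH.
move: hs'; rewrite mem_cat => /orP[] /mapP[r hr ->] /=.
  by rewrite (IH t) ?mem_head // addnAC.
by rewrite (ihs _ hr) ?addnA // => v hv; apply: IH; rewrite inE hv orbT.
Qed.

(** A grafting is linear exactly when both trees are linear and it takes place at the only leaf of
    [t], so at most one term is nonzero. The induction descends from the root, which has no child,
    one child or several. *)
Lemma count_pgraft_pladder u t n :
  count_mem (pladder n) (pgraft u t) =
  (\sum_(i < n) ((t == pladder i) && (u == pladder (n - i.+1))))%N.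
Proof.
have PE (a b : seq ptree) : (PNode a == PNode b) = (a == b).
  by apply/eqP/eqP => [[]|->].
elim: n t => [|n IH] [s].
  rewrite big_ord0 pgraftE /= count_map PE (eq_in_count (a2 := pred0)) ?count_pred0 //.
  by case: s => // t s [|? ?] /size_pgraft_below; rewrite /= PE.
rewrite big_ord_recl subn1 pgraftE /= count_map.
rewrite !PE; case: s => [|t [|t' s]].
- rewrite /= addn0 big1 => [|i _]; last by rewrite PE.
  by rewrite addn0 eqseq_cons eqxx andbT.
- rewrite /= cats0 count_map eqseq_cons andbF !add0n.
  rewrite (eq_count (a2 := pred1 (pladder n))); last first.
    by move=> r /=; rewrite PE eqseq_cons eqxx andbT.
  by rewrite IH; apply: eq_bigr => i _; rewrite /= PE eqseq_cons eqxx andbT subSS.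
- rewrite eqseq_cons andbF !add0n (eq_in_count (a2 := pred0)); last first.
    by move=> r /size_pgraft_below/=; case: r => [|? []] //= ? l _; rewrite PE eqseq_cons andbF.
  by rewrite count_pred0 big1 // => i _; rewrite /= PE eqseq_cons andbF.
Qed.

Lemma count_tgraft_ladder T U n :
  count_mem (ladder n) (tgraft T U) =
  (\sum_(i < n) ((T == ladder i) && (U == ladder (n - i.+1))))%N.
Proof.
rewrite count_map -[LHS]/(count _ _) (eq_count (a2 := pred1 (pladder n))).
  by rewrite count_pgraft_pladder; apply: eq_bigr => i _; rewrite !eq_ladder.
by move=> t /=; rewrite pi_eq_ladder.
Qed.

(** * The pre-Lie product on linear trees *)

Section Morphism.
Variable K : fieldType.
Implicit Types (f g x : PLhat K) (u v : That K).

Lemma fsum_seq (I : choiceType) (r : seq I) (F : I -> K^o) :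
  uniq r -> (forall i, i \notin r -> F i = 0) ->
  \sum_(i \in [set: I]) F i = \sum_(i <- r) F i.
Proof.
move=> ur h; rewrite (fsbigE r) //; last by move=> i _; exact: h.
by rewrite big_mkcond; apply: eq_bigr => i _; rewrite mem_set.
Qed.

Lemma prelie_ladder f g n :
  prelie f g (ladder n) = \sum_(i < n) f (ladder i) * g (ladder (n - i.+1)).
Proof.
pose p (i : nat) := (ladder i, ladder (n - i.+1)).
(* Written as a sum of indicators, the multiplicity shows that the support lies in the list of the
   [p i]. *)
have ct T U : f T * g U *+ count_mem (ladder n) (tgraft T U) =
    \sum_(i < n | (T, U) == p i) f (ladder i) * g (ladder (n - i.+1)).
  rewrite count_tgraft_ladder -sumrMnr [RHS]big_mkcond; apply: eq_bigr => i _.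
  by rewrite xpair_eqE; case: eqP => [->|_] //; case: eqP => [->|_].
rewrite /prelie (fsum_seq (r := [seq p i | i <- index_iota 0 n])).
- rewrite big_map big_mkord; apply: eq_bigr => i _.
  rewrite ct (big_pred1 i) // => j; rewrite xpair_eqE (inj_eq ladder_inj) eq_sym /= -val_eqE.
  by case: eqP => [->|] //=; rewrite eqxx.
- by rewrite map_inj_uniq ?iota_uniq // => i j [/ladder_inj].
- move=> [T U] h; rewrite ct big1 // => i /eqP e; case/negP: h.
  by rewrite e map_f // mem_index_iota ltn_ord.
Qed.

End Morphism.

(** * Rearrangement of finite sums *)

Section BigSums.
Variable V : nmodType.

Lemma big_ord_trunc (F : nat -> V) n m :
  (n <= m)%N -> (forall i, (n <= i)%N -> F i = 0) ->
  \sum_(i < m) F i = \sum_(i < n) F i.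
Proof.
move=> nm F0; rewrite -!(big_mkord xpredT) (@big_cat_nat _ _ _ n) //=.
rewrite [X in _ + X]big_nat_cond [X in _ + X]big1 ?addr0 // => i /andP[/andP[ni _] _].
exact: F0.
Qed.

Lemma big_ord_triangle (F : nat -> nat -> V) n :
  \sum_(k < n.+1) \sum_(i < k.+1) F i (k - i)%N =
  \sum_(i < n.+1) \sum_(j < (n - i).+1) F i j.
Proof.
elim: n => [|n IH]; first by rewrite !big_ord1.
rewrite big_ord_recr /= IH [RHS]big_ord_recr /= [X in _ + X]big_ord_recr /= subnn.
rewrite big_ord1 addrA -big_split /=; congr (_ + _); apply: eq_bigr => i _.
by rewrite subSn ?leq_ord // [RHS]big_ord_recr.
Qed.

End BigSums.

(** * Products and substitution of power series *)

Section PowerSeriesAlgebra.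
Variable K : fieldType.
Implicit Types a b c d w : pseries K.

Lemma ps_mulC a b : ps_mul a b = ps_mul b a.
Proof.
apply/funext => n; rewrite /ps_mul (reindex_inj rev_ord_inj) /=.
by apply: eq_bigr => i _; rewrite mulrC subSS subKn // leq_ord.
Qed.

Lemma ps_mulA a b c : ps_mul a (ps_mul b c) = ps_mul (ps_mul a b) c.
Proof.
apply/funext => n; rewrite /ps_mul.
have := big_ord_triangle (fun i j => a i * b j * c (n - (i + j))%N) n.
under [in X in X -> _]eq_bigr => k _.
  under eq_bigr => i _ do rewrite subnKC ?leq_ord //.
  rewrite -mulr_suml; over.
move=> ->; apply: eq_bigr => i _; rewrite mulr_sumr; apply: eq_bigr => j _.
by rewrite mulrA subnDA.
Qed.

Lemma ps_mul1 a : ps_mul (ps_one K) a = a.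
Proof.
apply/funext => n; rewrite /ps_mul big_ord_recl /= subn0 mul1r big1 ?addr0 // => i _.
by rewrite mul0r.
Qed.

Lemma ps_mulBr a b c : ps_mul a (b - c) = ps_mul a b - ps_mul a c.
Proof.
apply/funext => n; rewrite /ps_mul !fctE -sumrB.
by apply: eq_bigr => i _; rewrite -mulrBr.
Qed.

Lemma ps_mulX a n : ps_mul (ps_X K) a n = if n is m.+1 then a m else 0.
Proof.
rewrite /ps_mul /ps_X; case: n => [|n]; first by rewrite big_ord1 mul0r.
rewrite !big_ord_recl /= mul0r add0r mul1r subSS subn0 big1 ?addr0 // => i _.
by rewrite mul0r.
Qed.

(** Cancellation of a series of order exactly one: the coefficient of degree n.+1 in the product is
    a 1 * b n plus terms in earlier coefficients of b. *)
Lemma ps_mul_eq0 a b : a 0%N = 0 -> a 1%N != 0 -> ps_mul a b = 0 -> b = 0.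
Proof.
move=> a0 a1 ab; apply/funext => n; have [m] := ubnP n.
elim: m n => // m IH n nm; have := congr1 (fun s : pseries K => s n.+1) ab.
rewrite /ps_mul !big_ord_recl /= a0 mul0r add0r subSS subn0 big1 ?addr0 => [|i _].
  by move/eqP; rewrite mulf_eq0 (negPf a1) => /eqP.
by rewrite IH ?mulr0 // /bump /=; have := ltn_ord i; lia.
Qed.

Definition ps_pow a (k : nat) : pseries K := iter k (ps_mul a) (ps_one K).

Lemma ps_powD a k l : ps_pow a (k + l) = ps_mul (ps_pow a k) (ps_pow a l).
Proof. by elim: k => [|k IH]; rewrite ?ps_mul1 //= IH ps_mulA. Qed.

Lemma ps_pow_eq0 a k n : a 0%N = 0 -> (n < k)%N -> ps_pow a k n = 0.
Proof.
move=> a0; elim: k n => // k IH n nk; rewrite /= /ps_mul big_ord_recl a0 mul0r add0r.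
rewrite big1 // => i _; rewrite lift0 IH ?mulr0 //.
by case: n nk i => [|n] nk [i ?] /=; lia.
Qed.

(** The series c(w). Stopping at k = n is correct when w has no constant term, since w^k then has
    order at least k. *)
Definition ps_comp c w : pseries K := fun n => \sum_(k < n.+1) c k * ps_pow w k n.

Lemma ps_comp_widen c w n m : w 0%N = 0 -> (n <= m)%N ->
  ps_comp c w n = \sum_(k < m.+1) c k * ps_pow w k n.
Proof.
move=> w0 nm; rewrite (@big_ord_trunc _ (fun k => c k * ps_pow w k n) n.+1) // => k nk.
by rewrite ps_pow_eq0 // mulr0.
Qed.

(** Both sides sum c i * d j * w^(i+j), over the square i, j <= n or over the triangle i + j <= n;
    the terms outside the triangle have order above n. *)
Lemma ps_compM c d w : w 0%N = 0 ->
  ps_mul (ps_comp c w) (ps_comp d w) = ps_comp (ps_mul c d) w.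
Proof.
move=> w0; apply/funext => n; rewrite /ps_mul.
transitivity (\sum_(i < n.+1) \sum_(j < n.+1) c i * d j * ps_pow w (i + j) n).
  under eq_bigr => k _.
    rewrite (@ps_comp_widen _ _ _ n) // ?leq_ord //.
    rewrite (@ps_comp_widen d _ _ n) // ?leq_subr //.
    rewrite big_distrlr /=; over.
  rewrite exchange_big /=; apply: eq_bigr => i _.
  rewrite exchange_big /=; apply: eq_bigr => j _.
  by rewrite ps_powD /ps_mul mulr_sumr; apply: eq_bigr => k _; rewrite mulrACA.
transitivity (\sum_(i < n.+1) \sum_(j < (n - i).+1) c i * d j * ps_pow w (i + j) n).
  apply: eq_bigr => i _.
  rewrite (@big_ord_trunc _ (fun j => c i * d j * ps_pow w (i + j) n) (n - i).+1) //.
    by rewrite ltnS leq_subr.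
  by move=> j ij; rewrite ps_pow_eq0 ?mulr0 //; lia.
rewrite -(big_ord_triangle (fun i j => c i * d j * ps_pow w (i + j) n)).
apply: eq_bigr => k _; rewrite mulr_suml; apply: eq_bigr => i _.
by rewrite subnKC // leq_ord.
Qed.

Lemma ps_comp_X w : w 0%N = 0 -> ps_comp (ps_X K) w = w.
Proof.
move=> w0; apply/funext => n.
(* The sum is widened so that the index 1 occurs even when n = 0. *)
rewrite (@ps_comp_widen _ _ _ n.+1) // !big_ord_recl /= mul0r add0r mul1r.
rewrite big1 ?addr0 => [|i _]; last by rewrite mul0r.
by rewrite /bump /= ps_mulC ps_mul1.
Qed.

Lemma ps_comp_one w : ps_comp (ps_one K) w = ps_one K.
Proof.
apply/funext => n; rewrite /ps_comp big_ord_recl /= mul1r big1 ?addr0 // => i _.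
by rewrite mul0r.
Qed.

Lemma ps_compB c d w : ps_comp (c - d) w = ps_comp c w - ps_comp d w.
Proof.
apply/funext => n; rewrite /ps_comp !fctE -sumrB; apply: eq_bigr => k _.
by rewrite -mulrBl.
Qed.

End PowerSeriesAlgebra.

(** * Words of linear trees of a given weight *)

Fixpoint compositions_fuel (k n : nat) : seq (seq nat) :=
  if n is m.+1 then
    if k is l.+1 then
      [seq i :: c | i <- iota 0 n, c <- compositions_fuel l (m - i)]
    else [::]
  else [:: [::]].

(* The part i of a composition stands for the ladder with i.+1 vertices. *)
Definition compositions n := compositions_fuel n n.

Definition cweight (c : seq nat) : nat := sumn (map S c).

(** Each part uses up at least one unit of n, so a fuel of n or more never runs out. *)
Lemma compositions_fuel_irr k l n :
  (n <= k)%N -> (n <= l)%N -> compositions_fuel k n = compositions_fuel l n.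
Proof.
elim: k l n => [|k IH] [|l] [|n] // nk nl.
rewrite -[LHS]/([seq i :: c | i <- iota 0 n.+1, c <- compositions_fuel k (n - i)]).
rewrite -[RHS]/([seq i :: c | i <- iota 0 n.+1, c <- compositions_fuel l (n - i)]).
by congr flatten; apply: eq_map => i; rewrite (IH l) // (leq_trans (leq_subr _ _)).
Qed.

Lemma compositionsS n :
  compositions n.+1 = [seq i :: c | i <- iota 0 n.+1, c <- compositions (n - i)].
Proof.
rewrite -[LHS]/([seq i :: c | i <- iota 0 n.+1, c <- compositions_fuel n (n - i)]).
by congr flatten; apply: eq_map => i; rewrite (@compositions_fuel_irr n (n - i)) ?leq_subr.
Qed.

Lemma cweight_cons i c : cweight (i :: c) = (i + cweight c).+1.
Proof. by rewrite /cweight /= addSn. Qed.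

Lemma mem_compositions n c : (c \in compositions n) = (cweight c == n).
Proof.
elim: c n => [|i c IH] [|n] //.
  by rewrite compositionsS; apply/negbTE/negP => /allpairsPdep[i [c []]].
rewrite compositionsS cweight_cons eqSS.
apply/allpairsPdep/eqP => [[j [d [jn]]]|<-].
  by rewrite mem_iota in jn; move=> dn [-> cd]; move: dn; rewrite -cd IH => /eqP; lia.
by exists i, c; rewrite addKn IH eqxx mem_iota; split=> //; lia.
Qed.

Lemma uniq_compositions n : uniq (compositions n).
Proof.
have [m] := ubnP n; elim: m n => // m IH [|n] // nm.
rewrite compositionsS; apply: allpairs_uniq_dep.
- exact: iota_uniq.
- by move=> i _; apply: IH; have := leq_subr i n; lia.
- by move=> [i c] [j d] _ _ /= [-> ->].
Qed.

Lemma size_composition n c : c \in compositions n -> (size c <= n)%N.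
Proof.
rewrite mem_compositions => /eqP <-; elim: c => // i c IH.
by rewrite cweight_cons ltnS (leq_trans IH) ?leq_addl.
Qed.

Lemma wsize_ladders c : wsize (map ladder c) = cweight c.
Proof.
rewrite /wsize /cweight -map_comp; congr sumn.
by apply: eq_map => i /=; rewrite tsize_ladder.
Qed.

(** * The morphism to power series on trees and on words *)

Section Characters.
Variable K : fieldType.
Implicit Types (f g x : PLhat K) (u v : That K).

(** The shift is due to [ladder m] having m.+1 vertices: the linear tree with n vertices goes to
    x^n. *)
Definition ell f : pseries K := fun n => if n is m.+1 then f (ladder m) else 0.

(** Extends [ell] to the tensor algebra: a word of linear trees goes to x to the power of its
    weight, any other word to 0. *)
Definition wsum u : pseries K := fun n => \sum_(c <- compositions n) u (map ladder c).

Lemma ellD f g : ell (f + g) = ell f + ell g.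
Proof. by apply/funext => -[|n]; rewrite !fctE ?addr0. Qed.

Lemma ellN f : ell (- f) = - ell f.
Proof. by apply/funext => -[|n]; rewrite !fctE ?oppr0. Qed.

Lemma ellZ (c : K) f : ell (c *: f) = c *: ell f.
Proof. by apply/funext => -[|n]; rewrite !fctE ?scaler0. Qed.

Lemma ell_sum (I : Type) (r : seq I) (F : I -> PLhat K) :
  ell (\sum_(i <- r) F i) = \sum_(i <- r) ell (F i).
Proof.
by elim/big_rec2: _ => [|i y z _ <-]; [apply/funext => -[] | exact: ellD].
Qed.

Lemma ell_bullet : ell (bullet K) = ps_X K.
Proof.
apply/funext => -[|n] //; rewrite /ell /bullet /tbasis leaf_ladder.
by rewrite (inj_eq ladder_inj).
Qed.

Lemma ell_qscale (z : K) f n : ell (qscale z f) n = z ^+ n * ell f n.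
Proof. by case: n => [|n]; rewrite /= ?mulr0 // /qscale tsize_ladder. Qed.

Lemma ell_prelie f g : ell (prelie f g) = ps_mul (ell f) (ell g).
Proof.
apply/funext => -[|n]; first by rewrite /ps_mul big_ord1 mul0r.
rewrite /ps_mul big_ord_recl /= mul0r add0r big_ord_recr /= subnn mulr0 addr0.
rewrite prelie_ladder; apply: eq_bigr => i _; rewrite subSS.
by case: n i => [|n] [i /= ltin] //; rewrite subSS subSn.
Qed.

Definition tshift T u : That K := fun w => u (T :: w).

Lemma wsum0 u : wsum u 0%N = u [::].
Proof. by rewrite /wsum big_seq1. Qed.

Lemma wsumS u n : wsum u n.+1 = \sum_(i < n.+1) wsum (tshift (ladder i) u) (n - i)%N.
Proof.
rewrite /wsum compositionsS big_allpairs_dep -[iota 0 n.+1]/(index_iota 0 n.+1).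
by rewrite big_mkord.
Qed.

Lemma wsumB u v : wsum (u - v) = wsum u - wsum v.
Proof. by apply/funext => n; rewrite /wsum !fctE -sumrB. Qed.

Lemma wsumD u v : wsum (u + v) = wsum u + wsum v.
Proof. by apply/funext => n; rewrite /wsum !fctE -big_split. Qed.

Lemma wsum_nil u n : (forall T w, u (T :: w) = 0) -> wsum u n = u [::] *+ (n == 0%N).
Proof.
move=> u0; case: n => [|n]; first by rewrite wsum0.
rewrite wsumS big1 // => i _; rewrite /wsum big1 // => c _; exact: u0.
Qed.

Lemma wsum_tone : wsum (tone K) = ps_one K.
Proof. by apply/funext => n; rewrite wsum_nil // /tone eqxx. Qed.

Lemma wsum_tinj f : wsum (tinj f) = ell f.
Proof.
apply/funext => -[|n]; first by rewrite wsum0.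
rewrite wsumS big_ord_recr /= subnn wsum0 big1 ?add0r // => i _.
rewrite wsum_nil ?subn_eq0 1?leqNgt ?ltn_ord //; exact: mulr0n.
Qed.

(** A cut of [T :: w] falls either after [T] or in front of it, and in the latter case the left
    factor is [u [::]]. *)
Lemma tshift_tmul T u v : tshift T (tmul u v) = tmul (tshift T u) v + u [::] *: tshift T v.
Proof.
apply/funext => w; rewrite /tshift /tmul !fctE /= big_ord_recl /= addrC.
by congr (_ + _); apply: eq_bigr => i _.
Qed.

Lemma wsumZ (a : K) u n : wsum (a *: u) n = a * wsum u n.
Proof. by rewrite /wsum mulr_sumr. Qed.

(** The induction on the degree is for all u at once, because splitting off the first letter
    replaces u by [tshift]. *)
Lemma wsum_tmul u v : wsum (tmul u v) = ps_mul (wsum u) (wsum v).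
Proof.
apply/funext => n; have [m] := ubnP n; elim: m n u => // m IH [|n] u nm.
  by rewrite wsum0 /ps_mul /tmul !big_ord1 !wsum0.
transitivity (\sum_(i < n.+1) \sum_(j < (n - i).+1)
    wsum (tshift (ladder i) u) j * wsum v (n - (i + j))%N + u [::] * wsum v n.+1).
  rewrite wsumS (wsumS v) mulr_sumr -big_split /=; apply: eq_bigr => i _.
  rewrite tshift_tmul wsumD fctE wsumZ IH; last by have := leq_subr i n; lia.
  by congr (_ + _); apply: eq_bigr => j _; rewrite subnDA.
rewrite /ps_mul [RHS]big_ord_recl subn0 wsum0 [RHS]addrC; congr (_ + _).
rewrite -(big_ord_triangle (fun i j => wsum (tshift (ladder i) u) j * wsum v (n - (i + j))%N)).
apply: eq_bigr => k _; rewrite lift0 wsumS subSS mulr_suml; apply: eq_bigr => i _.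
by rewrite subnKC // leq_ord.
Qed.

Lemma wsum_tpow u k : wsum (tpow u k) = ps_pow (wsum u) k.
Proof. by elim: k => [|k IH]; rewrite ?wsum_tone //= wsum_tmul IH. Qed.

(** On a generator, [ell] turns the bracket into the commutator of the images, which cancels that of
    the two letters. *)
Lemma wsum_lie_ideal u : lie_ideal u -> wsum u = 0.
Proof.
elim=> [f g|{}u v _ u0 _ v0|{}u v _ v0|{}u v _ u0].
- by rewrite !wsumB !wsum_tmul !wsum_tinj /lie ellD ellN !ell_prelie subrr.
- by rewrite wsumD u0 v0 addr0.
- rewrite wsum_tmul v0; apply/funext => n; rewrite /ps_mul big1 // => i _; exact: mulr0.
- rewrite wsum_tmul u0; apply/funext => n; rewrite /ps_mul big1 // => i _; exact: mul0r.
Qed.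

(** The coefficient of x^n only sees words of weight n, where u agrees with an element of the
    ideal. *)
Lemma wsum_lie_ideal_closure u : u \in @lie_ideal_closure K -> wsum u = 0.
Proof.
move=> /asboolP hu; apply/funext => n; have [v /wsum_lie_ideal v0 uv] := hu n.
rewrite -v0 /wsum; apply: eq_big_seq => c; rewrite mem_compositions => /eqP cn.
by rewrite uv // wsize_ladders cn.
Qed.

(** The chosen representative differs from u by an element of the closed ideal, so [wsum] descends
    to [Uhat]. *)
Lemma wsum_repr u : wsum (repr (\pi_(Uhat K) u)) = wsum u.
Proof.
apply/eqP; rewrite -subr_eq0 -wsumB; apply/eqP/wsum_lie_ideal_closure.
rewrite (Quotient.idealrBE (GRing.ZmodClosed.clone (That K) (@lie_ideal_closure K) _)).
by apply/eqP; exact: (reprK (\pi_(Uhat K) u)).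
Qed.

End Characters.

(** * The action of the enveloping algebra on linear trees *)

Section Action.
Variable K : fieldType.
Implicit Types (f g x y : PLhat K) (u v : That K) (a b : Uhat K).

Lemma prelie_tbasis_ladder y j n :
  prelie y (tbasis K (ladder j)) (ladder n) =
  if (j < n)%N then y (ladder (n - j.+1)) else 0.
Proof.
rewrite prelie_ladder /tbasis; case: ltnP => jn; last first.
  rewrite big1 // => i _; rewrite (inj_eq ladder_inj).
  by case: eqP => [e|_]; [have := ltn_ord i; lia | exact: mulr0].
have lt : (n - j.+1 < n)%N by lia.
rewrite (bigD1 (Ordinal lt)) //= big1 ?addr0 => [|i].
  have -> : (n - (n - j.+1).+1 = j)%N by lia.
  by rewrite eqxx; exact: mulr1.
rewrite -val_eqE /= (inj_eq ladder_inj) => ne.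
by case: eqP => [e|_]; [have := ltn_ord i; lia | exact: mulr0].
Qed.

Lemma wact_ladders x c n :
  wact x (map ladder c) (ladder n) =
  if (cweight c <= n)%N then x (ladder (n - cweight c)) else 0.
Proof.
elim: c x => [|i c IH] x /=; first by rewrite subn0.
rewrite cweight_cons IH; case: ifP => cn; last by case: ifP => //; lia.
rewrite prelie_tbasis_ladder; case: ltnP => h; last by case: ifP => //; lia.
by rewrite ifT; [congr (x (ladder _)); lia | lia].
Qed.

Lemma wact_off_ladders y w n :
  (forall k, y (ladder k) = 0) -> wact y w (ladder n) = 0.
Proof.
elim: w y => // T w IH y y0 /=; apply: IH => k.
by rewrite prelie_ladder big1 // => i _; rewrite y0 mul0r.
Qed.

(** A letter that is not linear kills all linear coefficients, and later letters cannot restore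
    them. *)
Lemma wact_neq0 x w n : wact x w (ladder n) <> 0 -> exists c, w = map ladder c.
Proof.
elim: w x => [|T w IH] x; first by exists [::].
move=> /= h; have [c ->] := IH _ h.
have [[j ->]|nT] := pselect (exists j, T = ladder j); first by exists (j :: c).
case: h; apply: wact_off_ladders => k.
rewrite prelie_ladder big1 // => i _; rewrite /tbasis.
by case: eqP => [e|_]; [case: nT; exists (k - i.+1)%N | exact: mulr0].
Qed.

Lemma tact_ladder x u n :
  tact x u (ladder n) = \sum_(m < n.+1) wsum u m * x (ladder (n - m)).
Proof.
rewrite /tact (fsum_seq (r := [seq map ladder c | m <- iota 0 n.+1, c <- compositions m])).
- rewrite big_allpairs_dep -[iota 0 n.+1]/(index_iota 0 n.+1) big_mkord.
  apply: eq_bigr => m _; rewrite mulr_suml; apply: eq_big_seq => c.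
  rewrite mem_compositions => /eqP cm.
  by rewrite wact_ladders cm -ltnS ltn_ord.
- apply: allpairs_uniq_dep => [|m _|]; [exact: iota_uniq|exact: uniq_compositions|].
  move=> [i c] [j d] /allpairsPdep[i' [c' [_ hc [-> ->]]]].
  move=> /allpairsPdep[j' [d' [_ hd [-> ->]]]] /= /(inj_map ladder_inj) e.
  by move: hc hd; rewrite e !mem_compositions => /eqP <- /eqP <-.
- move=> w hw; have [->|/eqP/wact_neq0[c wc]] := eqVneq (wact x w (ladder n)) 0.
    exact: mulr0.
  rewrite wc wact_ladders; case: leqP => cn; last exact: mulr0.
  case/negP: hw; rewrite wc; apply/allpairsPdep; exists (cweight c), c.
  by rewrite mem_compositions mem_iota.
Qed.

Lemma ell_act x a : ell (act x a) = ps_mul (ell x) (wsum (repr a)).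
Proof.
rewrite ps_mulC; apply/funext => -[|n]; first by rewrite /ps_mul big_ord1 mulr0.
rewrite /ps_mul big_ord_recr /= subnn mulr0 addr0 /act tact_ladder.
by apply: eq_bigr => i _; rewrite subSn // leq_ord.
Qed.

Lemma wsum_reprB a b : wsum (repr (a - b)) = wsum (repr a) - wsum (repr b).
Proof.
rewrite -wsumB -(wsum_repr (repr a - repr b)); congr (wsum (repr _)).
by rewrite -[a in LHS]reprK -[b in LHS]reprK !piE.
Qed.

(** [tinj f] lives on one-letter words, hence its k-th power on words of length k; this justifies
    the cut-off in [Useries]. *)
Lemma tpow_tinj_eq0 f k w : size w != k -> tpow (tinj f) k w = 0.
Proof.
elim: k w => [|k IH] w wk; first by rewrite /= /tone -size_eq0 (negPf wk).
rewrite /= /tmul big1 // => i _; case: w wk i => [|T w] wk [[|i] ltiw] //=.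
- exact: mul0r.
- exact: mul0r.
case: (w) (ltiw) wk => [|U w'] lt wk; case: i {ltiw} lt => [|i] //= _.
- by rewrite IH ?mulr0.
- by rewrite IH ?mulr0.
- exact: mul0r.
Qed.

Lemma wsum_Useries c f : wsum (repr (Useries c f)) = ps_comp c (ell f).
Proof.
rewrite /Useries wsum_repr; apply/funext => n; rewrite /wsum /ps_comp.
transitivity (\sum_(s <- compositions n) \sum_(k < n.+1)
    c k * tpow (tinj f) k (map ladder s)).
  apply: eq_big_seq => s /size_composition sn; rewrite size_map.
  (* Words of weight n have length at most n, and the added powers vanish on them. *)
  rewrite -(@big_ord_trunc _ (fun k => c k * tpow (tinj f) k (map ladder s)) _ n.+1) //.
  by move=> k sk; rewrite tpow_tinj_eq0 ?mulr0 // size_map; lia.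
rewrite exchange_big /=; apply: eq_bigr => k _.
by rewrite -mulr_sumr -/(wsum _ n) wsum_tpow wsum_tinj.
Qed.

Lemma wsum_Uone : wsum (repr (Uone K)) = ps_one K.
Proof. by rewrite /Uone wsum_repr wsum_tone. Qed.

End Action.

(** * Uniqueness of the morphism *)

Lemma ptree_iso_size t u : ptree_iso t u -> psize t = psize u.
Proof. by elim=> //= *; lia. Qed.

Lemma psize_gt0 t : (0 < psize t)%N.
Proof. by case: t. Qed.

Definition root_arity (t : ptree) : nat := let: PNode s := t in size s.

Lemma ptree_iso_root_arity t u : ptree_iso t u -> root_arity t = root_arity u.
Proof. by elim=> //= *; lia. Qed.

(** A nonempty forest amounts to two smaller ones: the children of its first root and the remaining
    trees. *)
Lemma forests_bounded n :
  exists r : seq (seq ptree), forall s, (sumn (map psize s) <= n)%N -> s \in r.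
Proof.
elim: n => [|n [r hr]].
  by exists [:: [::]] => -[|[s] s'] //=.
exists ([::] :: [seq PNode s :: s' | s <- r, s' <- r]) => -[|[s] s'] //= h.
by rewrite inE; apply/orP; right; apply: allpairs_f; apply: hr; lia.
Qed.

Lemma rtrees_bounded n :
  exists2 r : seq rtree, uniq r & forall T, (tsize T <= n)%N -> T \in r.
Proof.
have [r hr] := forests_bounded n.
exists (undup [seq \pi_rtree (PNode s) | s <- r]); first exact: undup_uniq.
move=> T; rewrite mem_undup /tsize => Tn; apply/mapP.
case e: (repr T) Tn => [s] /= sn; exists s; first by apply: hr; lia.
by rewrite -e reprK.
Qed.

Lemma prelie_tbasis (K : fieldType) T U :
  prelie (tbasis K T) (tbasis K U) = \sum_(V <- tgraft T U) tbasis K V.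
Proof.
apply/funext => V; rewrite /prelie (fsum_seq (r := [:: (T, U)])) //.
  rewrite big_seq1 /= /tbasis !eqxx mulr1; elim: (tgraft T U) => [|W s IH] /=.
    by rewrite big_nil mulr0n.
  by rewrite big_cons fctE mulrnDr IH eq_sym.
move=> [T' U']; rewrite inE xpair_eqE /= /tbasis => /nandP[/negPf->|/negPf->].
  by rewrite mul0r mul0rn.
by rewrite mulr0 mul0rn.
Qed.

Section Uniqueness.
Variables (K : fieldType) (lam : PLhat K -> pseries K).
Hypothesis lamP : continuous_prelie_morphism lam.
Hypothesis lam_bullet : lam (bullet K) = ps_X K.

Lemma lamD f g : lam (f + g) = lam f + lam g.
Proof. by have := cpm_linear lamP 1 f g; rewrite !scale1r. Qed.

Lemma lam0 : lam 0 = 0.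
Proof. by apply: (addrI (lam 0)); rewrite -lamD !addr0. Qed.

Lemma lamZ (c : K) f : lam (c *: f) = c *: lam f.
Proof. by have := cpm_linear lamP c f 0; rewrite lam0 !addr0. Qed.

Lemma lam_sum (I : Type) (r : seq I) (F : I -> PLhat K) :
  lam (\sum_(i <- r) F i) = \sum_(i <- r) lam (F i).
Proof. by elim/big_rec2: _ => [|i y z _ <-]; [exact: lam0 | exact: lamD]. Qed.

(* The grafting of u on PNode s at the root is PNode (u :: s); the other ones
   have the same number of vertices but fewer children at the root. *)
Lemma lam_tbasis t : lam (tbasis K (\pi_rtree t)) = ell (tbasis K (\pi_rtree t)).
Proof.
(* Lexicographic induction on the number of vertices, then on the number of children of the root. *)
have [N] := ubnP (psize t); elim: N t => // N IHN t tN.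
have [M] := ubnP (root_arity t); elim: M t tN => // M IHM [[|u s]] tN tM.
  by rewrite -/leaf -/(bullet K) lam_bullet ell_bullet.
move: tN tM => /= tN tM.
have IHu : lam (tbasis K (\pi_rtree u)) = ell (tbasis K (\pi_rtree u)) by apply: IHN; lia.
have IHs : lam (tbasis K (\pi_rtree (PNode s))) = ell (tbasis K (\pi_rtree (PNode s))).
  by apply: IHN => /=; have := psize_gt0 u; lia.
have := cpm_prelie lamP (tbasis K (\pi_rtree (PNode s))) (tbasis K (\pi_rtree u)).
rewrite IHu IHs -ell_prelie prelie_tbasis /tgraft.
(* The product is formed on representatives, isomorphic to [u] and [PNode s], so sizes and root
   arities are unchanged. *)
have := iso_repr (PNode s); have := iso_repr u.
move: (repr (\pi_rtree u)) (repr (\pi_rtree (PNode s))) => u' [s'] uu' ss'.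
rewrite pgraftE map_cons !big_cons !big_map.
have -> : \pi_rtree (PNode (u' :: s')) = \pi_rtree (PNode (u :: s)).
  by apply/esym/eqP/rtree_eqP/ptree_iso_cons.
rewrite lamD lam_sum.
set b := tbasis K _; set r := pgraft_below u' s'.
(* All terms but the grafting at the root agree by induction and cancel. *)
rewrite ellD ell_sum (eq_big_seq (fun v => ell (tbasis K (\pi_rtree (PNode v))))).
  by move/addIr.
move=> v vr; apply: IHM => /=.
  have: PNode v \in pgraft u' (PNode s') by rewrite pgraftE inE map_f ?orbT.
  move/psize_pgraft => /= ->; rewrite -(ptree_iso_size uu').
  by have := ptree_iso_size ss' => /=; lia.
rewrite (size_pgraft_below vr).
by have := ptree_iso_root_arity ss' => /=; lia.
Qed.

Lemma lam_ell f : lam f = ell f.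
Proof.
apply/funext => n; have [m hm] := cpm_continuous lamP f n.
(* [f] is replaced by a finite combination of trees: the bound m serves the continuity of [lam], and
   n keeps the coefficient at the linear tree with n vertices. *)
have [r ur hr] := rtrees_bounded (maxn m n).
pose g : PLhat K := \sum_(T <- r) f T *: tbasis K T.
have gE T : T \in r -> g T = f T.
  move=> Tr; rewrite /g fct_sumE (bigD1_seq T) //= big1 ?addr0 => [|U UT].
    by rewrite !fctE /tbasis eqxx; exact: mulr1.
  by rewrite !fctE /tbasis eq_sym (negPf UT); exact: mulr0.
have -> : lam f n = lam g n.
  apply/esym/hm => // T Tm; apply: gE; apply: hr.
  by rewrite (leq_trans Tm) ?leq_maxl.
have -> : ell f n = ell g n.
  case: (n) hr => //= k hr; apply/esym/gE/hr.
  by rewrite tsize_ladder leq_maxr.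
rewrite /g lam_sum ell_sum; congr ((_ : pseries K) n).
apply: eq_bigr => T _; by rewrite lamZ ellZ -[T]reprK lam_tbasis.
Qed.

End Uniqueness.

(** * The two defining equations in power series *)

Lemma ps_exp_ell_Omega Omega : is_Omega Omega ->
  ps_comp (ps_exp rat - ps_one rat) (ell Omega) = ps_X rat.
Proof.
move=> OmegaP.
have w0 : ell Omega 0%N = 0 by [].
have eqw : ell Omega = ps_mul (ps_X rat) (ps_comp (@ps_todd rat) (ell Omega)).
  by rewrite -ell_bullet -wsum_Useries -ell_act; congr ell.
have w1 : ell Omega 1%N = 1.
  rewrite eqw ps_mulX /ps_comp big_ord1 /= mulr1 /ps_todd /=.
  by rewrite big_ord0 subr0.
(* Multiplying w = x * todd(w) by e^w - 1 gives w * (e^w - 1) = x * w, and w, of order exactly one,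
   cancels. *)
apply/eqP; rewrite -subr_eq0; apply/eqP/(@ps_mul_eq0 _ (ell Omega)) => //.
  by rewrite w1 oner_eq0.
rewrite ps_mulBr {1}eqw -ps_mulA ps_compM // ps_todd_mul ps_comp_X //.
by rewrite ps_mulC subrr.
Qed.

(** Coefficients of c(w) are polynomial in those of c and w; this carries the identity for Omega
    from Q to Q(q). *)
Lemma ps_comp_map (K L : fieldType) (phi : {rmorphism K -> L}) (c w : pseries K) n :
  ps_comp (fun k => phi (c k)) (fun k => phi (w k)) n = phi (ps_comp c w n).
Proof.
have powE l m : ps_pow (fun k => phi (w k)) l m = phi (ps_pow w l m).
  elim: l m => [|l IH] m; first by rewrite /= /ps_one rmorph_nat.
  by rewrite /= /ps_mul rmorph_sum; apply: eq_bigr => i _; rewrite rmorphM IH.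
by rewrite /ps_comp rmorph_sum; apply: eq_bigr => k _; rewrite rmorphM powE.
Qed.

Lemma ps_exp_ell_Omega_q Omega : is_Omega Omega ->
  ps_comp (ps_exp Qq - ps_one Qq) (ell (PLhat_Qq Omega)) = ps_X Qq.
Proof.
move=> OmegaP; pose phi : {rmorphism rat -> Qq} := @tofrac {poly rat} \o polyC.
apply/funext => n; have := congr1 (fun s : pseries rat => phi (s n)) (ps_exp_ell_Omega OmegaP).
rewrite -ps_comp_map /ps_X rmorph_nat => <-; congr (ps_comp _ _ n).
  by apply/funext => k; rewrite !fctE rmorphB fmorphV !rmorph_nat.
by apply/funext => -[|k] //=; rewrite rmorph0.
Qed.

(** The indeterminate is not a root of unity, as X^(n+1) and 1 differ in degree. *)
Lemma q_expn_neq1 n : q ^+ n.+1 - 1 != 0.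
Proof.
rewrite subr_eq0 /q -tofracXn -tofrac1 tofrac_eq.
apply/negP => /eqP/(congr1 (fun p : {poly rat} => size p)).
by rewrite size_polyXn size_poly1.
Qed.

Theorem mainTheorem7 (Omega : PLhat rat) (Omega_q : PLhat Qq)
    (lam : PLhat Qq -> pseries Qq) :
  is_Omega Omega ->
  is_Omega_q Omega Omega_q ->
  continuous_prelie_morphism lam ->
  lam (bullet Qq) = ps_X Qq ->
  lam Omega_q = qlog q.
Proof.
move=> OmegaP OmegaqP lamP lam_bullet; rewrite (lam_ell lamP lam_bullet).
set L := ell Omega_q.
have E := ps_exp_ell_Omega_q OmegaP.
have := congr1 (@ell Qq) OmegaqP.
rewrite !ellD ellN ellZ ell_prelie ell_bullet ell_act wsum_reprB wsum_Useries wsum_Uone.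
(* Writing 1 as a composite with w turns the factor into (e^x - 1)(w), which is x by [E]. *)
rewrite -(ps_comp_one (ell (PLhat_Qq Omega))) -ps_compB E -/L ps_mulC => eqL.
(* Coefficient of x^(n+1) in x L(qx) + L(qx) - L(x) = x L(x) + (q - 1) x. *)
have eqn n : q ^+ n * L n + q ^+ n.+1 * L n.+1 - L n.+1 = L n + (q - 1) * (n == 0%N)%:R.
  have := congr1 (fun s : pseries Qq => s n.+1) eqL.
  by rewrite !fctE !ps_mulX !ell_qscale.
have dL n : (q ^+ n.+1 - 1) * L n.+1 = (q - 1) * (-1) ^+ n.
  (* For a_m = (q^m - 1) L_m this is a recursion a_(m+1) = - a_m for m > 0, started by a_0 = 0 and
     a_1 = q - 1. *)
  have step m : (q ^+ m.+1 - 1) * L m.+1 = (q - 1) * (m == 0%N)%:R - (q ^+ m - 1) * L m.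
    rewrite (mulrBl (L m)) (mulrBl (L m.+1)) !mul1r opprB; apply: (addrI (q ^+ m * L m)).
    by rewrite addrA eqn [RHS]addrC -[RHS]addrA subrK addrC.
  elim: n => [|n IH]; first by rewrite step expr0 subrr mul0r subr0.
  by rewrite step mulr0 add0r IH exprS mulN1r mulrN.
apply/funext => -[|n] //=; have qn := q_expn_neq1 n; apply: (mulfI qn).
(* Since q^(n+1) - 1 = (q - 1) [n+1]_q, the q-integer is nonzero too. *)
rewrite dL; move: qn; rewrite subrX1 -/(qint q n.+1) mulf_eq0 negb_or => /andP[_ qn].
by rewrite -mulrA; congr (_ * _); rewrite mulrCA mulfV ?mulr1.
Qed.
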